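(* Let $T=[0,t_1]$ with $0<t_1<\infty$, let $U\subset\mathbb{R}^p$, and let $f:T\times\mathbb{R}^n\times U\to\mathbb{R}^n$, $L_r:T\times\mathbb{R}^n\times U\to\mathbb{R}$, $L_{mx}:T\times\mathbb{R}^n\to\mathbb{R}$, $\Psi:\mathbb{R}^n\to\mathbb{R}$, $x_0\in\mathbb{R}^n$. Assume: (A.0) $U$ is compact. (A.1) $f$ is continuous and there is $K_f>0$ such that for all $(s,u)\in T\times U$: $|f(s,x,u)-f(s,x',u)|\le K_f|x-x'|$ for all $x,x'\in\mathbb{R}^n$, and $|f(s,x,u)|\le K_f(1+|x|)$ for all $x\in\mathbb{R}^n$. (A.2) $L_r$, $L_{mx}$ and $\Psi$ are continuous, and there is $K_L<\infty$ such that $|L_{mx}(s,x)-L_{mx}(s,x')|\le K_L|x-x'|$ for all $s\in T$, $x,x'\in\mathbb{R}^n$. (A.5) There is $K_r>0$ such that for all $(s,u)\in T\times U$: $|L_r(s,x,u)-L_r(s,x',u)|\le K_r|x-x'|$ for all $x,x'\in\mathbb{R}^n$, and $|L_r(s,x,u)|\le K_r(1+|x|)$ for all $x\in\mathbb{R}^n$. Then for any $\epsilon>0$ there exists a pure control $\boldsymbol u^\epsilon\in\mathcal{U}$ which is $\epsilon$-optimal for the problem $$v_p(x_0)=\sup_{\boldsymbol u\in\mathcal{U}}J(x_0;\boldsymbol u),\qquad J(x_0;\boldsymbol u)=\int_0^{t_1}L_r(s,x(s),u(s))\,ds+\Psi(x(t_1))-\sup_{s\in T}L_{mx}(s,x(s)),$$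 where $x(\cdot)$ solves $\dot x(s)=f(s,x(s),u(s))$, $x(0)=x_0$.
   Context: $|\cdot|$ is the Euclidean norm. $\mathcal{U}$ is the set of measurable functions $\boldsymbol u:T\to U$ (pure controls). A control $\boldsymbol u^\epsilon\in\mathcal{U}$ is $\epsilon$-optimal if $J(x_0;\boldsymbol u^\epsilon)\ge v_p(x_0)-\epsilon$ (with $v_p(x_0)$ finite). The differential equation is understood in integral form (for almost every $s$). *)

(* Defs.v *)
From HB Require Import structures.
From mathcomp Require Import all_boot all_order all_algebra.
From mathcomp Require Import all_classical all_reals all_analysis.
Set Implicit Arguments.
Unset Strict Implicit.
Unset Printing Implicit Defensive.
Import Order.TTheory GRing.Theory Num.Theory.
Import numFieldNormedType.Exports.
Local Open Scope classical_set_scope.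
Local Open Scope ring_scope.

(* The norm that MathComp-Analysis puts on 'rV[R]_n is the sup norm, so the
   Euclidean norm is spelled out; both induce the library's topology. *)
Definition enorm (R : realType) (n : nat) (v : 'rV[R]_n) : R :=
  Num.sqrt (\sum_(i < n) v 0 i ^+ 2).

(* The real line with the Lebesgue (i.e. completed Borel, equivalently
   Caratheodory) sigma-algebra, on which completed_lebesgue_measure lives. *)
Notation lebesgueType R := (caratheodory_type (@wlength R idfun)^*%mu).

Notation borelType R p := (g_sigma_algebraType (@open 'rV[R]_p)).

Section ControlProblem.
Context (R : realType) (n p : nat).
Local Notation lambda := (@completed_lebesgue_measure R).

(* Functions on T = [0, t1], T x R^n x U, ... are encoded by total functions;
   every hypothesis and definition below only involves their values on the
   intended domain. *)
Variables (t1 : R) (U : set 'rV[R]_p).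
Variables (f : R -> 'rV[R]_n -> 'rV[R]_p -> 'rV[R]_n).
Variables (Lr : R -> 'rV[R]_n -> 'rV[R]_p -> R) (Lmx : R -> 'rV[R]_n -> R).
Variables (Psi : 'rV[R]_n -> R) (x0 : 'rV[R]_n).

Definition pure_control (u : R -> 'rV[R]_p) : Prop :=
  measurable_fun (`[0, t1] : set (lebesgueType R))
    (u : lebesgueType R -> borelType R p) /\
  (forall s, s \in `[0, t1] -> U (u s)).

(* x' = f(s, x, u), x(0) = x0 on [0, t1], in integral form.  Rintegral is total,
   hence the explicit integrability requirement. *)
Definition solves (u : R -> 'rV[R]_p) (x : R -> 'rV[R]_n) : Prop :=
  forall i : 'I_n,
    lambda.-integrable `[0, t1] (fun r => (f r (x r) (u r) 0 i)%:E) /\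
    forall s, s \in `[0, t1] ->
      x s 0 i = x0 0 i + \int[lambda]_(r in `[0, s]) f r (x r) (u r) 0 i.

(* The value off [0, t1], and everywhere if there is no solution, is junk. *)
Definition trajectory (u : R -> 'rV[R]_p) : R -> 'rV[R]_n :=
  xget (fun=> x0) (solves u).

Definition J (u : R -> 'rV[R]_p) : R :=
  let x := trajectory u in
  \int[lambda]_(s in `[0, t1]) Lr s (x s) (u s) + Psi (x t1)
  - sup [set Lmx s (x s) | s in `[0, t1]].

Definition v_p : \bar R := ereal_sup [set (J u)%:E | u in pure_control].

Definition eps_optimal (e : R) (u : R -> 'rV[R]_p) : Prop :=
  [/\ pure_control u, v_p \is a fin_num & (v_p - e%:E <= (J u)%:E)%E].

(* Existence of the trajectory, and uniqueness on [0, t1]: this is what makes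
   trajectory u the solution of the state equation. *)
Definition well_posed : Prop :=
  forall u, pure_control u ->
    exists x, solves u x /\
      forall y, solves u y -> {in `[0, t1], y =1 x}.

End ControlProblem.

(* Main.v *)
Require Import Defs.
From HB Require Import structures.
From mathcomp Require Import all_boot all_order all_algebra.
From mathcomp Require Import all_classical all_reals all_analysis.
From mathcomp Require Import measurable_realfun ring lra.
Set Implicit Arguments.
Unset Strict Implicit.
Unset Printing Implicit Defensive.
Import Order.TTheory GRing.Theory Num.Theory.
Import numFieldNormedType.Exports.
Local Open Scope classical_set_scope.
Local Open Scope ring_scope.

(** Once the value v_p(x0) is known to be finite, an eps-optimal control exists
    by the definition of a supremum.  Finiteness needs an admissible control,
    and any constant with value in U is one, together with a bound on J that is
    uniform in the control.  Such a bound comes from a bound on the trajectories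
    that does not depend on the control, so the analysis is about the state
    equation x(s) = x0 + int_0^s h(r, x(r)) dr, with h(r, x) = f(r, x, u(r)) for
    a fixed control u.

    Existence, uniqueness and the a priori bound all rest on one estimate.
    With the weight w(s) = exp(2 K s), which satisfies
    int_0^s w <= w(s) / (2 K), an integrand bounded by K c w has an integral
    bounded by (c / 2) w (weighted_integral_le).  If K is a Lipschitz and growth
    constant of h for the sup norm, the Picard operator therefore halves weighted
    distances (picard_contraction).  Any bound on a difference of two solutions,
    or on one solution up to an additive constant, can be halved again and again
    (weighted_bootstrap): this gives uniqueness (solution_unique) and a bound in
    terms of x0, K and t1 only (solution_uniform_bound).

    For existence, Picard iteration from the constant x0 stays in a class of
    functions with a fixed weighted bound and a fixed Lipschitz constant.  This
    class is closed under pointwise limits, the iterates converge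
    geometrically, and their limit is a fixed point (solution_exists).

    The integrands are only measurable in time, through the control.  That
    r |-> F(r, x(r), u(r)) is Lebesgue measurable for continuous F and x
    (measurable_controlled) is seen by freezing the time and the state on a fine
    grid: on each cell the integrand is a continuous function of u(r), and the
    frozen integrands converge as the grid is refined. *)

(** * Integrals for the completed Lebesgue measure *)

Section CompletedLebesgue.
Context {R : realType}.
Local Notation lambda := (@completed_lebesgue_measure R).

(** The completed measure and the Lebesgue measure are the same outer measure
    restricted to two sigma-algebras, so facts about intervals and Borel
    functions transfer through the identity map. *)
Lemma borel_lebesgue (A : set R) :
  measurable A -> measurable (A : set (lebesgueType R)).
Proof. by move=> mA; apply: sub_caratheodory. Qed.

Lemma measurable_id_lebesgue :
  measurable_fun [set: lebesgueType R] (id : lebesgueType R -> measurableTypeR R).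
Proof. by move=> _ Y mY; rewrite setTI; apply: borel_lebesgue. Qed.

Lemma measurable_itv_lebesgue (i : interval R) :
  measurable ([set` i] : set (lebesgueType R)).
Proof. by apply: borel_lebesgue; apply: measurable_itv. Qed.

Lemma lambda_itv (b c : bool) (a a' : R) : a <= a' ->
  lambda [set` Interval (BSide b a) (BSide c a')] = (a' - a)%:E.
Proof.
move=> aa'; transitivity
  (lebesgue_measure [set` Interval (BSide b a) (BSide c a')]); first by [].
rewrite lebesgue_measure_itv/= lte_fin; case: ltP => // a'a.
by rewrite (_ : a = a') ?subrr//; apply/le_anti; rewrite aa'.
Qed.

Lemma ge0_integral_lambda (D : set R) (g : R -> \bar R) :
  measurable D ->
  measurable_fun D g ->
  {in D, forall y, (0 <= g y)%E} ->
  (\int[lambda]_(x in D) g x = \int[lebesgue_measure]_(x in D) g x)%E.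
Proof.
move=> mD mg g0.
by rewrite -(@ge0_integral_pushforward _ _ _ _ R _ measurable_id_lebesgue lambda D g).
Qed.

Lemma ge0_integrable_lambda (D : set R) (g : R -> R) :
  measurable D ->
  {in D, forall y, 0 <= g y} ->
  lebesgue_measure.-integrable D (EFin \o g) ->
  lambda.-integrable D (EFin \o g).
Proof.
move=> mD g0 ig; have [mg gfin] := integrableP _ _ _ ig.
apply/integrableP; split.
  move=> mD' Y mY; apply: borel_lebesgue; exact: mg.
by rewrite ge0_integral_lambda//; exact: measurableT_comp.
Qed.

Lemma is_derive_expRM (k x : R) : is_derive x 1 (fun y => expR (k * y)) (k * expR (k * x)).
Proof.
have : is_derive (k * x) 1 expR (expR (k * x)) by exact: is_derive_expR.
move=> h.
have h2 : is_derive x 1 (fun y => k * y) k.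
  by apply: is_derive_eq; rewrite ?mulr1 /GRing.scale/= ?mulr1.
have := is_derive1_comp h h2.
by rewrite mulrC.
Qed.

Lemma continuous_expRM (k : R) : continuous (fun x => expR (k * x)).
Proof.
move=> x; apply/differentiable_continuous/derivable1_diffP.
by have [] := is_derive_expRM k x.
Qed.

Lemma integrable_expRM (k s : R) :
  lambda.-integrable `[0, s] (fun r => (expR (k * r))%:E).
Proof.
apply: ge0_integrable_lambda => //.
apply: continuous_compact_integrable; first exact: segment_compact.
by apply: continuous_subspaceT; exact: continuous_expRM.
Qed.

Lemma Rintegral_expRM (k s : R) : 0 < k -> 0 <= s ->
  \int[lambda]_(r in `[0, s]) expR (k * r) = (expR (k * s) - 1) / k.
Proof.
move=> k0; rewrite le_eqVlt => /predU1P[<-|s0].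
  rewrite mulr0 expR0 subrr mul0r set_itv1 /Rintegral ge0_integral_lambda//.
  - by rewrite integral_set1.
  - exact: measurable_fun_set1.
have mw : measurable_fun `[0, s] (fun x : R => (expR (k * x))%:E).
  apply/measurable_EFinP; apply: measurable_funTS.
  by apply: continuous_measurable_fun; exact: continuous_expRM.
rewrite /Rintegral ge0_integral_lambda//.
pose G x := expR (k * x) / k.
have dG (x : R) : is_derive x 1 G (expR (k * x)).
  have h := is_derive_expRM k x.
  have -> : G = (k^-1 *: (fun x => expR (k * x)))%R.
    by apply/funext => y; rewrite /G /= mulrC.
  by apply: is_derive_eq; rewrite /GRing.scale/= mulKf// gt_eqF.
have cG (x : R) : {for x, continuous G}.
  by apply/differentiable_continuous/derivable1_diffP; have [] := dG x.
rewrite (@continuous_FTC2 _ (fun x => expR (k * x)) G)//.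
- by rewrite /G mulr0 expR0 -EFinB /= mulrBl.
- by apply: continuous_subspaceT; exact: continuous_expRM.
- split.
  + by move=> x _; have [] := dG x.
  + by apply: cvg_at_right_filter; exact: cG.
  + by apply: cvg_at_left_filter; exact: cG.
- by move=> x _; rewrite derive1E; have [_ ->] := dG x.
Qed.

(** The rate 2 K of the weight is twice the constant K in the bound on the
    integrand, and this is where the factor 1 / 2 comes from.  The term - 1 is
    kept: it leaves room for an initial value in an estimate of x0 plus an
    integral. *)
Lemma weighted_integral_le (K c t1 s : R) (g : R -> R) :
  0 < K -> s \in `[0, t1] ->
  lambda.-integrable `[0, t1] (EFin \o g) ->
  (forall r, r \in `[0, s] -> `|g r| <= K * c * expR (2 * K * r)) ->
  `|\int[lambda]_(r in `[0, s]) g r| <= c / 2 * (expR (2 * K * s) - 1).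
Proof.
move=> K0 /[!in_itv]/= /andP[s0 st] ig gc.
have mI : measurable (`[0, s]%classic : set (lebesgueType R)).
  exact: measurable_itv_lebesgue.
have igs : lambda.-integrable `[0, s] (EFin \o g).
  apply: integrableS ig => //; first exact: measurable_itv_lebesgue.
  by apply: subset_itvl; rewrite bnd_simp.
apply: le_trans (le_normr_Rintegral _ igs) _ => //.
have iw := integrable_expRM (2 * K) s.
apply: le_trans (_ : \int[lambda]_(r in `[0, s]) (K * c * expR (2 * K * r)) <= _).
  apply: le_Rintegral => //=.
  - exact: integrable_norm igs.
  - by apply: (integrableZl mI (K * c) iw).
rewrite RintegralZl// Rintegral_expRM//; last by rewrite mulr_gt0.
rewrite [leLHS](_ : _ = c / 2 * (expR (2 * K * s) - 1))//; field.
by rewrite gt_eqF.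
Qed.

Lemma norm_Rintegral_le (b c : bool) (a a' M : R) (g : R -> R) : a <= a' ->
  lambda.-integrable [set` Interval (BSide b a) (BSide c a')] (EFin \o g) ->
  (forall r, r \in Interval (BSide b a) (BSide c a') -> `|g r| <= M) ->
  `|\int[lambda]_(r in [set` Interval (BSide b a) (BSide c a')]) g r|
    <= M * (a' - a).
Proof.
move=> aa' ig gM; set D := [set` _] in ig *.
have mD : measurable (D : set (lebesgueType R)) by exact: measurable_itv_lebesgue.
apply: le_trans (le_normr_Rintegral mD ig) _.
apply: le_trans (_ : \int[lambda]_(r in D) M <= _).
  apply: le_Rintegral => //=.
  - by have := integrable_norm ig.
  - apply: measurable_bounded_integrable => //.
      by have := ltry (a' - a); rewrite -(lambda_itv b c aa').
    exact: bounded_cst.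
by rewrite Rintegral_cst// [X in fine X](lambda_itv b c aa').
Qed.

Lemma integral_itv_diff_le (t1 M s s' : R) (g : R -> R) :
  s \in `[0, t1] -> s' \in `[0, t1] ->
  lambda.-integrable `[0, t1] (EFin \o g) ->
  (forall r, r \in `[0, t1] -> `|g r| <= M) ->
  `|\int[lambda]_(r in `[0, s]) g r - \int[lambda]_(r in `[0, s']) g r|
    <= M * `|s - s'|.
Proof.
wlog: s s' / s' <= s.
  move=> wh hs hs' ig gM; have [ss'|ss'] := leP s' s; first exact: wh.
  by rewrite distrC (distrC s); apply: wh => //; exact: ltW.
move=> s's; rewrite !in_itv/= => /andP[s0 st] /andP[s'0 s't] ig gM.
have mI (i : interval R) : measurable ([set` i] : set (lebesgueType R)).
  exact: measurable_itv_lebesgue.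
have iS (i : interval R) : [set` i] `<=` `[0, t1] -> lambda.-integrable [set` i] (EFin \o g).
  by move=> iT; apply: integrableS ig.
have sub : `]s', s]%classic `<=` `[0, t1]%classic.
  by apply: subset_itv; rewrite bnd_simp.
have -> : `[0, s]%classic = `[0, s']%classic `|` `]s', s]%classic.
  by rewrite -itv_bndbnd_setU ?bnd_simp.
rewrite Rintegral_setU//; last 2 first.
- rewrite -itv_bndbnd_setU ?bnd_simp//; apply: iS; apply: subset_itvl.
  by rewrite bnd_simp.
- apply/disj_setPS => y [/=]; rewrite 2!in_itv/= => /andP[_ yx] /andP[].
  by rewrite ltNge yx.
rewrite addrC addKr.
rewrite (ger0_norm (_ : 0 <= s - s')) ?subr_ge0//.
by apply: norm_Rintegral_le (iS _ sub) _ => // r rs; apply: gM; exact: sub.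
Qed.

Lemma bounded_integrable (t1 M : R) (g : R -> R) : 0 <= t1 ->
  @measurable_fun _ _ (lebesgueType R) R `[0, t1] g ->
  (forall r, r \in `[0, t1] -> `|g r| <= M) ->
  lambda.-integrable `[0, t1] (EFin \o g).
Proof.
move=> t0 mg gM; apply: measurable_bounded_integrable => //.
- exact: measurable_itv_lebesgue.
- by have := ltry (t1 - 0); rewrite -(lambda_itv true false t0).
- exists M; split; first exact: num_real.
  by move=> x Mx y /gM /le_trans; apply; exact: ltW.
Qed.

End CompletedLebesgue.

(** * Measurability of integrands driven by a control *)

Lemma cvg_within_seq (S V : topologicalType) (A : set S) (g : S -> V)
    (z : nat -> S) (l : S) :
  {within A, continuous g} -> A l -> (forall k, A (z k)) ->
  z @ \oo --> l -> (fun k => g (z k)) @ \oo --> g l.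
Proof.
move=> /subspace_continuousP gc Al Az zl; apply: cvg_comp (gc _ Al).
move=> P wP; have : \forall k \near \oo, A (z k) -> P (z k) by exact: zl wP.
by apply: (@filterS _ \oo) => k; apply; exact: Az.
Qed.

Section ControlledMeasurability.
Context {R : realType} {X : topologicalType} {p : nat}.
Variables (t1 : R) (U : set 'rV[R]_p) (F : R -> X -> 'rV[R]_p -> R).
Hypothesis F_cont : {within [set z : R * X * 'rV[R]_p |
    z.1.1 \in `[0, t1] /\ U z.2], continuous (fun z => F z.1.1 z.1.2 z.2)}.
Variable u : R -> 'rV[R]_p.
Hypothesis u_control : pure_control t1 U u.

(** An open set of values pulls back to a relatively open set of triples, hence
    to a set of control values that is open in U, and the control is measurable
    for the Borel sets. *)
Lemma measurable_frozen_state (s : R) (y : X) : s \in `[0, t1] ->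
  @measurable_fun _ _ (lebesgueType R) R `[0, t1] (fun r => F s y (u r)).
Proof.
move=> sT; have [mu uU] := u_control.
have mT := measurable_itv_lebesgue `[0, t1].
apply: (measurability _ (RGenOpens.measurableE R)).
move=> _ [_ [a [b ->]] <-].
have oab : open (`]a, b[%classic : set R) by exact: interval_open.
have /continuousP/(_ _ oab)/open_subspaceP[W oW WE] := F_cont.
have oS : open [set v : 'rV[R]_p | W (s, y, v)].
  suff : continuous (fun v : 'rV[R]_p => (s, y, v)) by move/continuousP; apply.
  move=> v; apply: (@cvg_pair _ _ _ (nbhs v) (nbhs (s, y)) (nbhs v) _ _ _
    (cst (s, y)) id); [exact: cvg_cst|exact: cvg_id].
have mS : measurable ([set v | W (s, y, v)] : set (borelType R p)).
  exact: sub_sigma_algebra.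
have := mu mT _ mS.
congr (measurable _); apply/seteqP; split=> r /= [rT].
- move=> Wr; split=> //.
  by have /seteqP[/(_ (s, y, u r))/= h _] := WE; apply h; split => //; split => //; exact: uU.
- move=> Fr; split=> //.
  by have /seteqP[_ /(_ (s, y, u r))/= h] := WE; apply h; split => //; split => //; exact: uU.
Qed.

Definition grid_floor (k : nat) (r : R) : R :=
  (Num.truncn (r * k.+1%:R))%:R / k.+1%:R.

Lemma grid_floorP k r : 0 <= r ->
  [/\ 0 <= grid_floor k r, grid_floor k r <= r & r - k.+1%:R^-1 <= grid_floor k r].
Proof.
move=> r0; rewrite /grid_floor.
have k0 : 0 < k.+1%:R :> R by rewrite ltr0n.
have /truncn_itv/andP[h1 h2] : 0 <= r * k.+1%:R by rewrite mulr_ge0// ltW.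
split; first by rewrite divr_ge0// ltW.
- by rewrite ler_pdivrMr.
- rewrite ler_pdivlMr// mulrBl mulVf ?gt_eqF// lerBlDr natr1.
  exact: ltW.
Qed.

Lemma grid_floor_itv k r : r \in `[0, t1] -> grid_floor k r \in `[0, t1].
Proof.
rewrite !in_itv/= => /andP[r0 rt]; have [-> gr _] := grid_floorP k r0.
exact: le_trans gr rt.
Qed.

Lemma cvg_grid_floor r : 0 <= r -> grid_floor ^~ r @ \oo --> r.
Proof.
move=> r0; apply: (@squeeze_cvgr _ _ _ _ (fun k => r - k.+1%:R^-1) (cst r)).
- by apply: nearW => k; have [_ -> ->] := grid_floorP k r0.
- rewrite -[X in _ --> X]subr0; apply: cvgB; first exact: cvg_cst.
  exact: cvg_harmonic.
- exact: cvg_cst.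
Qed.

(** On each cell of the grid of step 1 / (k + 1) the frozen integrand is
    measurable, and continuity of F and x lets k go to infinity.  The grid is
    rounded down, so that the frozen time stays in [0, t1], where F and x are
    known to be continuous. *)
Lemma measurable_controlled (x : R -> X) : {within `[0, t1], continuous x} ->
  @measurable_fun _ _ (lebesgueType R) R `[0, t1] (fun r => F r (x r) (u r)).
Proof.
move=> x_cont; have mT := measurable_itv_lebesgue `[0, t1].
have [_ uU] := u_control.
pose a := grid_floor.
apply: (@measurable_fun_cvg _ (lebesgueType R) R `[0, t1]%classic
  (fun k r => F (a k r) (x (a k r)) (u r))) => [k|r rT].
  pose E j := `[0, t1]%classic `&` `[j%:R / k.+1%:R, j.+1%:R / k.+1%:R[%classic : set R.
  have -> : `[0, t1]%classic = \bigcup_j E j.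
    apply/seteqP; split=> [r rT|r [j _ []]//].
    exists (Num.truncn (r * k.+1%:R)) => //; split => //=.
    rewrite in_itv/= ler_pdivrMr ?ltr0n// ltr_pdivlMr ?ltr0n//.
    apply: truncn_itv; rewrite mulr_ge0//.
    by move: rT; rewrite /= in_itv/= => /andP[].
  have mE j : measurable (E j : set (lebesgueType R)).
    by apply: measurableI => //; exact: measurable_itv_lebesgue.
  apply/measurable_fun_bigcup => // j.
  have aE r : E j r -> a k r = j%:R / k.+1%:R.
    case=> _ /=; rewrite in_itv/= ler_pdivrMr ?ltr0n// ltr_pdivlMr ?ltr0n//.
    by move=> /truncn_def; rewrite /a /grid_floor => ->.
  (* The frozen time of an empty cell may lie outside [0, t1], where F is not
     controlled, so empty cells are set apart. *)
  have [[r0 Er0]|E0] := pselect (E j !=set0); last first.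
    move=> _ Y mY; rewrite (_ : _ `&` _ = set0)//.
    by apply/seteqP; split => // r [Er _]; case: E0; exists r.
  apply: (@eq_measurable_fun _ _ (lebesgueType R) R (E j)
    (fun r => F (a k r0) (x (a k r0)) (u r))).
    by move=> r /[!inE] Er; rewrite (aE _ Er) (aE _ Er0).
  apply: (measurable_funS mT) (measurable_frozen_state _ _); first by move=> r [].
  by apply: grid_floor_itv; case: Er0.
have r0 : 0 <= r by move: rT; rewrite /= in_itv/= => /andP[].
have ar : a ^~ r @ \oo --> r by exact: cvg_grid_floor.
have xr : (fun k => x (a k r)) @ \oo --> x r.
  by apply: (cvg_within_seq x_cont) => // k; exact: grid_floor_itv.
have az : (fun k => (a k r, x (a k r), u r)) @ \oo --> (r, x r, u r).
  apply: (@cvg_pair _ _ _ \oo (nbhs (r : R, x r)) (nbhs (u r)) _ _ _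
    (fun k => (a k r, x (a k r))) (cst (u r))); last exact: cvg_cst.
  exact: (@cvg_pair _ _ _ \oo (nbhs (r : R)) (nbhs (x r)) _ _ _
    (fun k => a k r) (fun k => x (a k r))).
apply: (cvg_within_seq F_cont _ _ az) => [|k]; split => /=; try exact: uU.
  exact: rT.
exact: grid_floor_itv.
Qed.

End ControlledMeasurability.

(** * The sup norm of row vectors and elementary limits *)

Section RowVectorNorm.
Context {R : realType} {n : nat}.
Implicit Type v : 'rV[R]_n.

Lemma coord_le_norm v i : `|v 0 i| <= `|v|.
Proof.
rewrite [leRHS]/Num.norm/= mx_normrE.
exact: (le_bigmax _ (fun ij => `|v ij.1 ij.2|) (0, i)).
Qed.

Lemma norm_le_coord v c : 0 <= c -> (forall i, `|v 0 i| <= c) -> `|v| <= c.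
Proof.
move=> c0 vc; rewrite [leLHS]/Num.norm/= mx_normrE; apply/bigmax_leP; split => // -[j i] _ /=.
by rewrite (ord1 j).
Qed.

End RowVectorNorm.

Lemma cvg_halving {R : realType} (c : R) : (fun k => c / 2 ^+ k) @ \oo --> 0.
Proof.
have : geometric c (2^-1 : R) @ \oo --> 0.
  by apply: cvg_geometric; rewrite ger0_norm ?invr_ge0// invf_lt1 ?ltr1n.
by apply: cvg_trans; apply: near_eq_cvg; apply: nearW => k /=; rewrite exprVn.
Qed.

Lemma le_halving {R : realType} (a b c : R) :
  (forall k, a <= b + c / 2 ^+ k) -> a <= b.
Proof.
move=> h; have cv : (fun k => b + c / 2 ^+ k) @ \oo --> b.
  rewrite -[X in _ --> X]addr0; apply: cvgD; first exact: cvg_cst.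
  exact: cvg_halving.
by apply: cvgr_to_ge cv _; exact: nearW.
Qed.

Lemma lipschitz_continuous_within {R : realType} {V : normedModType R}
    (A : set R) (L : R) (x : R -> V) :
  (forall s s', A s -> A s' -> `|x s - x s'| <= L * `|s - s'|) ->
  {within A, continuous x}.
Proof.
move=> xL; apply/subspace_continuousP => s As; apply/cvgrPdist_le => e e0.
rewrite near_withinE.
have d0 : 0 < e / (`|L| + 1) by rewrite divr_gt0// ltr_wpDl.
near=> s' => As'; apply: le_trans (xL _ _ As As') _.
have : `|s - s'| <= e / (`|L| + 1).
  by near: s'; apply: (@cvgr_dist_le _ _ _ _ _ id) => //; exact: cvg_id.
rewrite ler_pdivlMr ?ltr_wpDl// => /(le_trans _); apply.
rewrite mulrC ler_wpM2l//.
by apply: le_trans (ler_norm _) _; rewrite lerDl.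
Unshelve. all: by end_near. Qed.

(** * The integral equation *)

Section IntegralEquation.
Context {R : realType} {n : nat}.
Local Notation lambda := (@completed_lebesgue_measure R).
Variables (t1 K : R) (h : R -> 'rV[R]_n -> 'rV[R]_n) (x0 : 'rV[R]_n).
Hypothesis t1_gt0 : 0 < t1.
Hypothesis K_gt0 : 0 < K.
Hypothesis h_lip : forall s x x' i, s \in `[0, t1] ->
  `|h s x 0 i - h s x' 0 i| <= K * `|x - x'|.
Hypothesis h_growth : forall s x i, s \in `[0, t1] ->
  `|h s x 0 i| <= K * (1 + `|x|).
Hypothesis h_meas : forall x i, {within `[0, t1], continuous x} ->
  @measurable_fun _ _ (lebesgueType R) R `[0, t1] (fun r => h r (x r) 0 i).

(** [Rintegral] of a non-integrable function is a junk value, so integrability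
    along a candidate is carried separately from the fixed point equation. *)
Definition integrable_along (x : R -> 'rV[R]_n) := forall i,
  lambda.-integrable `[0, t1] (fun r => (h r (x r) 0 i)%:E).

Definition picard (x : R -> 'rV[R]_n) (s : R) : 'rV[R]_n :=
  x0 + \row_i \int[lambda]_(r in `[0, s]) h r (x r) 0 i.

Local Notation w s := (expR (2 * K * s)).

Lemma weight_ge1 s : s \in `[0, t1] -> 1 <= w s.
Proof.
rewrite in_itv/= => /andP[s0 _]; rewrite -expR0 ler_expR mulr_ge0// ltW//.
by rewrite mulr_gt0.
Qed.

(** Iterating the step from c = M gives the bounds 2 B + M / 2 ^ k, whose limit
    2 B no longer remembers M: a crude bound is turned into one that depends on
    the data only. *)
Lemma weighted_bootstrap (phi : R -> R) (B M : R) : 0 <= B -> 0 <= M ->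
  {in `[0, t1], forall s, phi s <= M * w s} ->
  (forall c, 0 <= c -> {in `[0, t1], forall s, phi s <= c * w s} ->
    {in `[0, t1], forall s, phi s <= (B + c / 2) * w s}) ->
  {in `[0, t1], forall s, phi s <= 2 * B * w s}.
Proof.
move=> B0 M0 phiM step s sT.
have iterate k : {in `[0, t1], forall s, phi s <= (2 * B + M / 2 ^+ k) * w s}.
  elim: k => [r rT|k IH r rT].
    apply: le_trans (phiM r rT) _; rewrite ler_wpM2r ?expR_ge0//.
    by rewrite expr0 divr1 lerDr mulr_ge0.
  have c0 : 0 <= 2 * B + M / 2 ^+ k.
    by rewrite addr_ge0 ?mulr_ge0// divr_ge0// exprn_ge0.
  have := step _ c0 IH r rT; congr (_ <= _ * _).
  rewrite exprS; field.
  by rewrite expf_neq0//.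
apply: (@le_halving _ _ _ (M * w s)) => k; have := iterate k s sT.
by rewrite mulrDl [X in _ + X]mulrAC.
Qed.

Lemma integral_sub_le (g : R -> R) s : s \in `[0, t1] ->
  lambda.-integrable `[0, t1] (EFin \o g) -> lambda.-integrable `[0, s] (EFin \o g).
Proof.
rewrite in_itv/= => /andP[s0 st] ig.
apply: integrableS ig; try exact: measurable_itv_lebesgue.
by apply: subset_itvl; rewrite bnd_simp.
Qed.

Lemma itv_sub s r : s \in `[0, t1] -> r \in `[0, s] -> r \in `[0, t1].
Proof.
rewrite !in_itv/= => /andP[_ st] /andP[-> rs]; exact: le_trans rs st.
Qed.

(** As w >= 1, the growth bound K (1 + c w) is at most K (1 + c) w. *)
Lemma picard_weighted_bound x c s : 0 <= c -> integrable_along x ->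
  {in `[0, t1], forall r, `|x r| <= c * w r} -> s \in `[0, t1] ->
  `|picard x s| <= `|x0| + (1 + c) / 2 * (w s - 1).
Proof.
move=> c0 ix xc sT; apply: le_trans (ler_normD _ _) _; rewrite lerD2l.
apply: norm_le_coord => [|i].
  apply: mulr_ge0; first by rewrite divr_ge0 ?addr_ge0.
  by rewrite subr_ge0 weight_ge1.
rewrite mxE; apply: (weighted_integral_le K_gt0 sT (ix i)) => r rs.
have rT := itv_sub sT rs.
apply: le_trans (h_growth _ _ rT) _; rewrite -mulrA ler_wpM2l ?(ltW K_gt0)//.
by rewrite mulrDl mul1r lerD ?weight_ge1// xc.
Qed.

Lemma picard_contraction x y c s : 0 <= c -> integrable_along x -> integrable_along y ->
  {in `[0, t1], forall r, `|x r - y r| <= c * w r} -> s \in `[0, t1] ->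
  `|picard x s - picard y s| <= c / 2 * w s.
Proof.
move=> c0 ix iy xyc sT; rewrite /picard opprD addrACA subrr add0r.
apply: norm_le_coord => [|i]; first by rewrite mulr_ge0 ?divr_ge0 ?expR_ge0.
have mI := measurable_itv_lebesgue `[0, s].
rewrite !mxE -RintegralB//; last 2 first.
  exact: (integral_sub_le sT (ix i)).
  exact: (integral_sub_le sT (iy i)).
have ixy : lambda.-integrable `[0, t1]
    (EFin \o (fun r => h r (x r) 0 i - h r (y r) 0 i)).
  have := integrableB (measurable_itv_lebesgue `[0, t1]) (ix i) (iy i).
  by apply: eq_integrable => //; exact: measurable_itv_lebesgue.
apply: le_trans (weighted_integral_le (c := c) K_gt0 sT ixy _) _ => [r rs|].
  have rT := itv_sub sT rs.
  by apply: le_trans (h_lip _ _ _ rT) _; rewrite -mulrA ler_wpM2l ?xyc// ltW.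
by rewrite ler_wpM2l ?divr_ge0// lerBlDr lerDl.
Qed.

Lemma picard_lipschitz x M : 0 <= M -> integrable_along x ->
  (forall i, {in `[0, t1], forall r, `|h r (x r) 0 i| <= M}) ->
  {in `[0, t1] &, forall s s', `|picard x s - picard x s'| <= M * `|s - s'|}.
Proof.
move=> M0 ix hM s s' sT s'T; rewrite /picard opprD addrACA subrr add0r.
apply: norm_le_coord => [|i]; first by rewrite mulr_ge0.
by rewrite !mxE; apply: (integral_itv_diff_le sT s'T (ix i)); exact: hM.
Qed.

Section Solutions.
Variable x : R -> 'rV[R]_n.
Hypothesis x_int : integrable_along x.
Hypothesis x_fix : {in `[0, t1], forall s, x s = picard x s}.

(** A solution is bounded for the mere reason that its derivative is integrable.
    The bound depends on the solution; it only starts the bootstrap. *)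
Lemma solution_bounded :
  exists2 M, 0 <= M & {in `[0, t1], forall s, `|x s| <= M}.
Proof.
pose G i := \int[lambda]_(r in `[0, t1]) `|h r (x r) 0 i|.
have G0 i : 0 <= G i by apply: Rintegral_ge0 => *; exact: normr_ge0.
exists (`|x0| + \sum_i G i); first by rewrite addr_ge0// sumr_ge0.
move=> s sT; rewrite x_fix//; apply: le_trans (ler_normD _ _) _; rewrite lerD2l.
apply: norm_le_coord => [|i]; first exact: sumr_ge0.
rewrite mxE; apply: (@le_trans _ _ (G i)); last first.
  by rewrite (bigD1 i)//= lerDl sumr_ge0.
have mI := measurable_itv_lebesgue `[0, s].
have mT := measurable_itv_lebesgue `[0, t1].
have iG := integrable_norm (x_int i).
apply: le_trans (le_normr_Rintegral mI (integral_sub_le sT (x_int i))) _.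
rewrite /G /Rintegral fine_le//.
- by apply: integrable_fin_num => //; exact: (integral_sub_le sT iG).
- exact: integrable_fin_num.
- apply: ge0_subset_integral => //.
  + exact: measurable_int iG.
  + by move=> r rs; exact: itv_sub sT rs.
Qed.

(** The bootstrap step, with additive constant B = |x0| + 1 / 2, is the growth
    estimate of the Picard operator. *)
Lemma solution_apriori_bound :
  {in `[0, t1], forall s, `|x s| <= (2 * `|x0| + 1) * w s}.
Proof.
have [M M0 xM] := solution_bounded.
have -> : 2 * `|x0| + 1 = 2 * (`|x0| + 2^-1) by rewrite mulrDr mulfV.
apply: (weighted_bootstrap _ M0) => [|s sT|c c0 xc s sT].
- by rewrite addr_ge0.
- by apply: le_trans (xM s sT) _; rewrite ler_peMr// weight_ge1.
- rewrite x_fix//; apply: le_trans (picard_weighted_bound c0 x_int xc sT) _.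
  have := weight_ge1 sT; have := normr_ge0 x0; nra.
Qed.

Let C := (2 * `|x0| + 1) * w t1.

Lemma solution_uniform_bound : {in `[0, t1], forall s, `|x s| <= C}.
Proof.
move=> s sT; apply: le_trans (solution_apriori_bound sT) _.
have N0 : 0 <= 2 * `|x0| + 1 by rewrite addr_ge0// mulr_ge0.
rewrite ler_wpM2l// ler_expR ler_wpM2l ?mulr_ge0// ?(ltW K_gt0)//.
by move: sT; rewrite in_itv/= => /andP[].
Qed.

Lemma solution_continuous : {within `[0, t1], continuous x}.
Proof.
have C0 : 0 <= C by rewrite mulr_ge0 ?expR_ge0// addr_ge0// mulr_ge0.
apply: (@lipschitz_continuous_within _ _ _ (K * (1 + C))) => s s' sT s'T.
rewrite (x_fix sT) (x_fix s'T); apply: picard_lipschitz => //.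
  by rewrite mulr_ge0 ?addr_ge0// ltW.
move=> i r rT; apply: le_trans (h_growth _ _ rT) _.
by rewrite ler_wpM2l ?(ltW K_gt0)// lerD2l solution_uniform_bound.
Qed.

End Solutions.

(** The bootstrap step for the difference of two solutions has B = 0. *)
Lemma solution_unique x y : integrable_along x -> integrable_along y ->
  {in `[0, t1], forall s, x s = picard x s} ->
  {in `[0, t1], forall s, y s = picard y s} -> {in `[0, t1], x =1 y}.
Proof.
move=> ix iy xE yE.
have [M M0 xM] := solution_bounded ix xE; have [M' M'0 yM] := solution_bounded iy yE.
suff xy : {in `[0, t1], forall s, `|x s - y s| <= 2 * 0 * w s}.
  move=> s /xy; rewrite mulr0 mul0r normr_le0 subr_eq0 => /eqP //.
apply: (@weighted_bootstrap _ _ (M + M')) => [||s sT|c c0 xyc s sT]//.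
- by rewrite addr_ge0.
- apply: (@le_trans _ _ (M + M')).
    by apply: le_trans (ler_normB _ _) _; rewrite lerD ?xM ?yM.
  by rewrite ler_peMr ?weight_ge1// addr_ge0.
- by rewrite add0r xE// yE//; exact: picard_contraction.
Qed.

Let N := `|x0| + 1.
Let L := K * (1 + N * w t1).

(** The constant N = |x0| + 1 is stable because |x0| + (1 + N) / 2 (w - 1) <= N w,
    and L bounds h along functions satisfying the first condition.  Both
    conditions survive pointwise limits, which spares a discussion of uniform
    convergence, and the second one provides the continuity needed for
    measurability. *)
Definition picard_class (x : R -> 'rV[R]_n) :=
  {in `[0, t1], forall s, `|x s| <= N * w s} /\
  {in `[0, t1] &, forall s s', `|x s - x s'| <= L * `|s - s'|}.

Let N_ge1 : 1 <= N.
Proof. by rewrite lerDr. Qed.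

Let N_ge0 : 0 <= N.
Proof. exact: le_trans N_ge1. Qed.

Lemma picard_class_growth x i : picard_class x ->
  {in `[0, t1], forall r, `|h r (x r) 0 i| <= L}.
Proof.
move=> [xN _] r rT; apply: le_trans (h_growth _ _ rT) _.
rewrite /L ler_wpM2l ?(ltW K_gt0)// lerD2l; apply: le_trans (xN r rT) _.
rewrite ler_wpM2l// ler_expR ler_wpM2l ?mulr_ge0// ?(ltW K_gt0)//.
by move: rT; rewrite in_itv/= => /andP[].
Qed.

Lemma picard_class_continuous x : picard_class x -> {within `[0, t1], continuous x}.
Proof.
by move=> [_ xL]; apply: (@lipschitz_continuous_within _ _ _ L) => s s'; exact: xL.
Qed.

Lemma picard_class_integrable x : picard_class x -> integrable_along x.
Proof.
move=> xP i; apply: (@bounded_integrable _ _ L); first exact: ltW.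
  by apply: h_meas; exact: picard_class_continuous.
exact: picard_class_growth.
Qed.

Lemma picard_class_stable x : picard_class x -> picard_class (picard x).
Proof.
move=> xP; have ix := picard_class_integrable xP; have [xN xL] := xP; split.
  move=> s sT; apply: le_trans (picard_weighted_bound N_ge0 ix xN sT) _.
  have := weight_ge1 sT; have : `|x0| <= N by rewrite lerDl.
  have := N_ge1; nra.
apply: (picard_lipschitz _ ix) => [|i]; last exact: picard_class_growth.
by rewrite mulr_ge0 ?addr_ge0 ?mulr_ge0 ?expR_ge0// ltW.
Qed.

Let y k := iter k picard (fun=> x0).

Let y_class k : picard_class (y k).
Proof.
elim: k => [|k IH]; last exact: picard_class_stable.
split=> [s sT|s s' _ _] /=.
  apply: (@le_trans _ _ N); first by rewrite lerDl.
  by rewrite ler_peMr// weight_ge1.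
by rewrite subrr normr0 mulr_ge0// mulr_ge0 ?addr_ge0 ?mulr_ge0 ?expR_ge0// ltW.
Qed.

Let y_int k : integrable_along (y k) := picard_class_integrable (y_class k).

Let y_step k s : s \in `[0, t1] ->
  `|y k.+1 s - y k s| <= 2 * N / 2 ^+ k * w s.
Proof.
elim: k s => [|k IH] s sT.
  rewrite expr0 divr1 mulr_natl mulr2n mulrDl.
  by apply: le_trans (ler_normB _ _) _; rewrite lerD// (y_class _).1.
have -> : 2 * N / 2 ^+ k.+1 = 2 * N / 2 ^+ k / 2.
  by rewrite exprS; field; rewrite expf_neq0.
have c0 : 0 <= 2 * N / 2 ^+ k by rewrite divr_ge0 ?mulr_ge0// exprn_ge0.
exact: (picard_contraction c0 (y_int k.+1) (y_int k) IH sT).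
Qed.

(* 4 N / 2 ^ k is the sum of the step bounds 2 N / 2 ^ i over all i >= k. *)
Let y_tail k j s : s \in `[0, t1] ->
  `|y (k + j)%N s - y k s| <= (4 * N / 2 ^+ k - 4 * N / 2 ^+ (k + j)) * w s.
Proof.
move=> sT; elim: j => [|j IH]; first by rewrite addn0 !subrr normr0 mul0r.
rewrite addnS -(subrKA (y (k + j)%N s)); apply: le_trans (ler_normD _ _) _.
apply: le_trans (lerD (y_step (k + j) sT) IH) _.
rewrite -mulrDl ler_wpM2r ?expR_ge0//.
rewrite [leRHS](_ : _ = 2 * N / 2 ^+ (k + j) + (4 * N / 2 ^+ k - 4 * N / 2 ^+ (k + j)))//.
by rewrite exprS; field; rewrite !expf_neq0.
Qed.

Let y_cvg s : s \in `[0, t1] -> cvgn (fun k => y k s).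
Proof.
move=> sT.
apply/cauchy_cvgP; apply: cauchy_exP => e e0.
have /cvgrPdist_lt/(_ e e0)[k _ /(_ k (leqnn k))/= small] :=
  cvg_halving (4 * N * w s).
exists (y k s); have : \forall m \near \oo, ball (y k s) e (y m s).
  near=> m; have km : (k <= m)%N by near: m; exact: nbhs_infty_ge.
  rewrite -ball_normE /ball_/= distrC -(subnKC km).
  apply: le_lt_trans (y_tail k (m - k) sT) _.
  apply: (@le_lt_trans _ _ (4 * N / 2 ^+ k * w s)).
    by rewrite ler_wpM2r ?expR_ge0// gerBl divr_ge0 ?exprn_ge0// mulr_ge0.
  apply: le_lt_trans (ler_norm _) _.
  by move: small; rewrite sub0r normrN mulrAC.
by [].
Unshelve. all: by end_near. Qed.

Let norm_lim_le (z : nat -> 'rV[R]_n) (l : 'rV[R]_n) (c : R) :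
  z @ \oo --> l -> (\forall k \near \oo, `|z k| <= c) -> `|l| <= c.
Proof. by move=> zl; apply: cvgr_to_le (cvg_norm zl). Qed.

(** The limit z of the iterates is again in the class.  It is fixed because both
    z and its image under the Picard operator are within a multiple of
    w / 2 ^ k of the iterate of rank k + 1. *)
Theorem solution_exists : exists2 x, integrable_along x &
  {in `[0, t1], forall s, x s = picard x s}.
Proof.
pose z s := limn (fun k => y k s).
have yz s : s \in `[0, t1] -> (fun k => y k s) @ \oo --> z s by exact: y_cvg.
have zP : picard_class z.
  split=> [s sT|s s' sT s'T].
    by apply: (norm_lim_le (yz s sT)); apply: nearW => k; exact: (y_class k).1.
  apply: (norm_lim_le (cvgB (yz s sT) (yz s' s'T))); apply: nearW => k.
  exact: (y_class k).2.
have yz_dist k s : s \in `[0, t1] -> `|z s - y k s| <= 4 * N / 2 ^+ k * w s.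
  move=> sT; apply: (norm_lim_le (cvgB (yz s sT) (cvg_cst (y k s)))).
  near=> m; have km : (k <= m)%N by near: m; exact: nbhs_infty_ge.
  have := y_tail k (m - k) sT; rewrite subnKC// => /le_trans; apply.
  by rewrite ler_wpM2r ?expR_ge0// gerBl divr_ge0 ?exprn_ge0// mulr_ge0.
have iz := picard_class_integrable zP.
exists z => // s sT; apply/eqP; rewrite -subr_eq0 -normr_le0.
apply: (@le_halving _ _ _ (4 * N * w s)) => k; rewrite add0r.
rewrite -(subrKA (y k.+1 s)); apply: le_trans (ler_normD _ _) _.
have dk : 0 <= 4 * N / 2 ^+ k by rewrite divr_ge0 ?exprn_ge0// mulr_ge0.
have h1 := picard_contraction dk iz (y_int k) (fun r => yz_dist k r) sT.
have h2 := yz_dist k.+1 s sT.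
rewrite (distrC (y k.+1 s)); apply: le_trans (lerD h2 h1) _.
rewrite -mulrDl [leRHS]mulrAC ler_wpM2r ?expR_ge0//.
rewrite [leLHS](_ : _ = 4 * N / 2 ^+ k)//.
by rewrite exprS; field; rewrite expf_neq0.
Unshelve. all: by end_near. Qed.

End IntegralEquation.

(** * Euclidean and sup norms, bounds for the cost *)

Section EuclideanNorm.
Context {R : realType} {n : nat}.
Implicit Type v : 'rV[R]_n.

Lemma coord_le_enorm v i : `|v 0 i| <= enorm v.
Proof.
rewrite -sqrtr_sqr /enorm ler_wsqrtr// (bigD1 i)//= lerDl sumr_ge0// => j _.
exact: sqr_ge0.
Qed.

Lemma enorm_le_norm v : enorm v <= Num.sqrt n%:R * `|v|.
Proof.
rewrite -[X in _ * X]ger0_norm// -sqrtr_sqr -sqrtrM ?ler0n//.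
rewrite /enorm ler_wsqrtr//.
apply: (@le_trans _ _ (\sum_(i < n) `|v| ^+ 2)).
  apply: ler_sum => i _; rewrite -real_normK ?num_real//.
  by rewrite lerXn2r ?nnegrE ?coord_le_norm.
by rewrite sumr_const card_ord mulr_natl.
Qed.

End EuclideanNorm.

Lemma continuous_le_on_ball {R : realType} {n : nat} (g : 'rV[R]_n -> R) (C : R) :
  continuous g -> exists M, forall v, `|v| <= C -> g v <= M.
Proof.
move=> gc; have [C0|C0] := ltP C 0.
  by exists 0 => v /(le_trans (normr_ge0 v)); rewrite leNgt C0.
pose B := [set v : 'rV[R]_n | `|v| <= C].
have cB : compact B.
  apply: bounded_closed_compact.
    by exists C; split; [exact: num_real|move=> M CM v vC; exact: le_trans vC (ltW CM)].
  have /continuous_closedP/(_ [set r : R | r <= C]) : continuous (@Num.norm _ 'rV[R]_n).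
    exact: norm_continuous.
  by apply; exact: closed_le.
have [c _ gM] : exists2 c, c \in B & forall t, t \in B -> g t <= g c.
  apply: EVT_max_rV => //; first by exists 0; rewrite /B/= normr0.
  exact: continuous_subspaceT.
by exists (g c) => v vC; apply: gM; rewrite inE.
Qed.

(** The absolute value accommodates a set A that is not bounded above, whose real
    supremum is 0 by convention. *)
Lemma oppr_sup_le {R : realType} (A : set R) (a : R) : A a -> - sup A <= `|a|.
Proof.
move=> Aa; have [sA|nA] := pselect (has_sup A); last by rewrite sup_out// oppr0.
rewrite lerNl; apply: (@le_trans _ _ a); first by rewrite lerNl -normrN ler_norm.
by apply: ub_le_sup => //; exact: sA.2.
Qed.

(** * The controlled system and the value *)

Section ControlProblemTheory.
Context {R : realType} {n p : nat}.
Local Notation lambda := (@completed_lebesgue_measure R).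
Variables (t1 : R) (U : set 'rV[R]_p).
Variables (f : R -> 'rV[R]_n -> 'rV[R]_p -> 'rV[R]_n) (x0 : 'rV[R]_n) (Kf : R).
Hypothesis t1_gt0 : 0 < t1.
Hypothesis f_cont : {within [set z : R * 'rV[R]_n * 'rV[R]_p |
    z.1.1 \in `[0, t1] /\ U z.2], continuous (fun z => f z.1.1 z.1.2 z.2)}.
Hypothesis Kf_gt0 : 0 < Kf.
Hypothesis f_bound : forall s u, s \in `[0, t1] -> U u ->
  (forall x x', enorm (f s x u - f s x' u) <= Kf * enorm (x - x')) /\
  (forall x, enorm (f s x u) <= Kf * (1 + enorm x)).

(* The Euclidean norm is at most sqrt n times the sup norm, so K is a Lipschitz
   and growth constant of the coordinates of f for the sup norm. *)
Let cn : R := Num.sqrt n%:R.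
Let K := Kf * (1 + cn).

Let cn_ge0 : 0 <= cn. Proof. exact: sqrtr_ge0. Qed.

Lemma sup_norm_constant_gt0 : 0 < K.
Proof. by rewrite mulr_gt0// ltr_pwDl. Qed.

Section FixedControl.
Variable u : R -> 'rV[R]_p.
Hypothesis u_control : pure_control t1 U u.

Let h s x := f s x (u s).

Lemma controlled_lipschitz s x x' i : s \in `[0, t1] ->
  `|h s x 0 i - h s x' 0 i| <= K * `|x - x'|.
Proof.
move=> sT; have [fl _] := f_bound sT (u_control.2 s sT).
have -> : h s x 0 i - h s x' 0 i = (h s x - h s x') 0 i by rewrite !mxE.
apply: le_trans (coord_le_enorm _ i) _; apply: le_trans (fl x x') _.
rewrite /K -mulrA ler_wpM2l ?(ltW Kf_gt0)//; apply: le_trans (enorm_le_norm _) _.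
by rewrite ler_wpM2r// lerDr.
Qed.

Lemma controlled_growth s x i : s \in `[0, t1] -> `|h s x 0 i| <= K * (1 + `|x|).
Proof.
move=> sT; have [_ fg] := f_bound sT (u_control.2 s sT).
apply: le_trans (coord_le_enorm _ i) _; apply: le_trans (fg x) _.
rewrite /K -mulrA ler_wpM2l ?(ltW Kf_gt0)//.
have := enorm_le_norm x; have := normr_ge0 x; have := cn_ge0.
rewrite -/cn; nra.
Qed.

Lemma controlled_measurable (x : R -> 'rV[R]_n) i : {within `[0, t1], continuous x} ->
  @measurable_fun _ _ (lebesgueType R) R `[0, t1] (fun r => h r (x r) 0 i).
Proof.
apply: (@measurable_controlled _ _ _ t1 U (fun s y v => f s y v 0 i)) => //.
move=> z; apply: (@continuous_comp (subspace _) _ _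
  (fun z => f z.1.1 z.1.2 z.2) (fun v : 'rV[R]_n => v 0 i)); first exact: f_cont.
exact: coord_continuous.
Qed.

Lemma solvesP (x : R -> 'rV[R]_n) : solves t1 f x0 u x <->
  integrable_along t1 h x /\ {in `[0, t1], forall s, x s = picard h x0 x s}.
Proof.
split=> [xs|[ix xE] i].
  split=> [i|s sT]; first exact: (xs i).1.
  by apply/rowP => i; rewrite !mxE; exact: (xs i).2.
by split=> [|s sT]; [exact: ix|rewrite {1}xE// !mxE].
Qed.

Lemma solves_exists_unique : exists x, solves t1 f x0 u x /\
  forall y, solves t1 f x0 u y -> {in `[0, t1], y =1 x}.
Proof.
have [x ix xE] := solution_exists x0 t1_gt0 sup_norm_constant_gt0
  controlled_lipschitz controlled_growth controlled_measurable.
exists x; split=> [|y /solvesP[iy yE]]; first exact/solvesP.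
exact: (solution_unique sup_norm_constant_gt0 controlled_lipschitz iy ix yE xE).
Qed.

Lemma trajectory_solves : solves t1 f x0 u (trajectory t1 f x0 u).
Proof. by apply: xgetPex; have [x [xs _]] := solves_exists_unique; exists x. Qed.

Let C := (2 * `|x0| + 1) * expR (2 * K * t1).

Lemma trajectory_bound : {in `[0, t1], forall s, `|trajectory t1 f x0 u s| <= C}.
Proof.
have [ix xE] := (solvesP _).1 trajectory_solves.
exact: (solution_uniform_bound sup_norm_constant_gt0 controlled_growth ix xE).
Qed.

Lemma trajectory_continuous : {within `[0, t1], continuous (trajectory t1 f x0 u)}.
Proof.
have [ix xE] := (solvesP _).1 trajectory_solves.
exact: (solution_continuous sup_norm_constant_gt0 controlled_growth ix xE).
Qed.

End FixedControl.

Variables (Lr : R -> 'rV[R]_n -> 'rV[R]_p -> R) (Lmx : R -> 'rV[R]_n -> R).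
Variables (Psi : 'rV[R]_n -> R) (KL Kr : R).
Hypothesis Lr_cont : {within [set z : R * 'rV[R]_n * 'rV[R]_p |
    z.1.1 \in `[0, t1] /\ U z.2], continuous (fun z => Lr z.1.1 z.1.2 z.2)}.
Hypothesis Psi_cont : continuous Psi.
Hypothesis Lmx_lip : forall s x x', s \in `[0, t1] ->
  `|Lmx s x - Lmx s x'| <= KL * enorm (x - x').
Hypothesis Kr_gt0 : 0 < Kr.
Hypothesis Lr_growth : forall s u, s \in `[0, t1] -> U u ->
  forall x, `|Lr s x u| <= Kr * (1 + enorm x).

(** The trajectories stay in the ball of radius C.  On it the running cost is
    controlled by its growth and Psi by compactness; the supremum of Lmx along a
    trajectory is bounded below by its value at time 0. *)
Lemma J_bounded : exists M, forall u, pure_control t1 U u ->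
  J t1 f Lr Lmx Psi x0 u <= M.
Proof.
set C := (2 * `|x0| + 1) * expR (2 * K * t1).
have [P PsiP] := continuous_le_on_ball C Psi_cont.
exists (Kr * (1 + cn * C) * t1 + P + (`|Lmx 0 0| + `|KL| * (cn * C))) => u uc.
have := trajectory_bound uc; have := trajectory_continuous uc.
rewrite /J -/C; set x := trajectory t1 f x0 u => xcont xC.
have T0 : 0 \in `[0, t1] by rewrite in_itv/= lexx ltW.
have T1 : t1 \in `[0, t1] by rewrite in_itv/= lexx ltW.
have exC s : s \in `[0, t1] -> enorm (x s) <= cn * C.
  by move=> sT; apply: le_trans (enorm_le_norm _) _; rewrite ler_wpM2l ?xC.
have LrB s : s \in `[0, t1] -> `|Lr s (x s) (u s)| <= Kr * (1 + cn * C).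
  move=> sT; apply: le_trans (Lr_growth sT (uc.2 s sT) _) _.
  by rewrite ler_wpM2l ?(ltW Kr_gt0)// lerD2l exC.
apply: lerD; first apply: lerD.
- have iL : lambda.-integrable `[0, t1] (EFin \o (fun s => Lr s (x s) (u s))).
    apply: (bounded_integrable (ltW t1_gt0) _ LrB).
    exact: (measurable_controlled Lr_cont uc).
  apply: le_trans (ler_norm _) _.
  apply: le_trans (norm_Rintegral_le (ltW t1_gt0) iL LrB) _.
  by rewrite subr0.
- by apply: PsiP; exact: xC.
- apply: (@le_trans _ _ `|Lmx 0 (x 0)|).
    by apply: oppr_sup_le; exists 0.
  rewrite -[Lmx 0 (x 0)](subrK (Lmx 0 0)) addrC.
  apply: le_trans (ler_normD _ _) _; rewrite lerD2l.
  apply: le_trans (Lmx_lip _ _ T0) _; rewrite subr0.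
  apply: (@le_trans _ _ (`|KL| * enorm (x 0))).
    by rewrite ler_wpM2r ?sqrtr_ge0// ler_norm.
  by rewrite ler_wpM2l ?exC.
Qed.

End ControlProblemTheory.

Lemma constant_control {R : realType} (p : nat) (t1 : R) (U : set 'rV[R]_p) v :
  U v -> pure_control t1 U (fun=> v).
Proof. by move=> Uv; split=> //; exact: measurable_cst. Qed.

Lemma bounded_eps_optimal {R : realType} (n p : nat) (t1 : R) (U : set 'rV[R]_p)
    f Lr Lmx Psi (x0 : 'rV[R]_n) (M e : R) :
  U !=set0 -> (forall u, pure_control t1 U u -> J t1 f Lr Lmx Psi x0 u <= M) ->
  0 < e -> exists u, eps_optimal t1 U f Lr Lmx Psi x0 e u.
Proof.
move=> [v Uv] JM e0.
have vfin : v_p t1 U f Lr Lmx Psi x0 \is a fin_num.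
  apply: fin_real; apply/andP; split.
    apply: lt_le_trans (ltNyr (J t1 f Lr Lmx Psi x0 (fun=> v))) _.
    by apply: ereal_sup_ubound; exists (fun=> v) => //; exact: constant_control.
  apply: le_lt_trans (ltry M); apply: ge_ereal_sup => _ [u uc <-].
  by rewrite lee_fin JM.
have [_ [u uc <-] /ltW uopt] := ub_ereal_sup_adherent e0 vfin.
by exists u.
Qed.

Theorem corollary1 (R : realType) (n p : nat) (t1 : R) (U : set 'rV[R]_p)
  (f : R -> 'rV[R]_n -> 'rV[R]_p -> 'rV[R]_n)
  (Lr : R -> 'rV[R]_n -> 'rV[R]_p -> R) (Lmx : R -> 'rV[R]_n -> R)
  (Psi : 'rV[R]_n -> R) (x0 : 'rV[R]_n)
  (t1_gt0 : 0 < t1)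
  (U_nonempty : U !=set0)
  (* (A.0) *)
  (U_compact : compact U)
  (* (A.1) *)
  (f_cont : {within [set z : R * 'rV[R]_n * 'rV[R]_p |
               z.1.1 \in `[0, t1] /\ U z.2],
             continuous (fun z => f z.1.1 z.1.2 z.2)})
  (f_bound : exists Kf : R, 0 < Kf /\
     forall s u, s \in `[0, t1] -> U u ->
       (forall x x', enorm (f s x u - f s x' u) <= Kf * enorm (x - x')) /\
       (forall x, enorm (f s x u) <= Kf * (1 + enorm x)))
  (* (A.2) *)
  (Lr_cont : {within [set z : R * 'rV[R]_n * 'rV[R]_p |
                z.1.1 \in `[0, t1] /\ U z.2],
              continuous (fun z => Lr z.1.1 z.1.2 z.2)})
  (Lmx_cont : {within [set z : R * 'rV[R]_n | z.1 \in `[0, t1]],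
               continuous (fun z => Lmx z.1 z.2)})
  (Psi_cont : continuous Psi)
  (Lmx_lip : exists KL : R, forall s x x', s \in `[0, t1] ->
     `|Lmx s x - Lmx s x'| <= KL * enorm (x - x'))
  (* (A.5) *)
  (Lr_bound : exists Kr : R, 0 < Kr /\
     forall s u, s \in `[0, t1] -> U u ->
       (forall x x', `|Lr s x u - Lr s x' u| <= Kr * enorm (x - x')) /\
       (forall x, `|Lr s x u| <= Kr * (1 + enorm x))) :
  well_posed t1 U f x0 /\
  forall e : R, 0 < e ->
    exists u : R -> 'rV[R]_p, eps_optimal t1 U f Lr Lmx Psi x0 e u.
Proof.
have [Kf [Kf_gt0 f_b]] := f_bound.
have [KL L_lip] := Lmx_lip.
have [Kr [Kr_gt0 L_b]] := Lr_bound.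
split=> [u uc|e e_gt0]; first exact: (solves_exists_unique x0 t1_gt0 f_cont Kf_gt0 f_b uc).
have Lr_growth s u : s \in `[0, t1] -> U u ->
  forall x, `|Lr s x u| <= Kr * (1 + enorm x) by move=> sT Uu; exact: (L_b s u sT Uu).2.
have [M JM] := J_bounded x0 t1_gt0 f_cont Kf_gt0 f_b Lr_cont Psi_cont L_lip
  Kr_gt0 Lr_growth.
exact: bounded_eps_optimal JM e_gt0.
Qed.
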